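(* Let $G$ be a finite group with non-commuting graph $\Gamma_G$. Then $\Gamma_G$ is Q-integral in each of the following cases: (a) $G\cong D_{2r}$, $M_{2rs}$ or $SD_{8r}$, where $r$ is odd and $8r^2-16r+9$ is a perfect square. (b) $G\cong V_{8n}$, where $n$ is even and $8n^2-16n+9$ is a perfect square. (c) $G\cong Q_{4n}$ or $G/Z(G)\cong D_{2n}$, where $8n^2-16n+9$ is a perfect square. (d) $G\cong D_{2r}$ or $M_{2rs}$, where $r$ is even and $2r^2-8r+9$ is a perfect square. (e) $G\cong V_{8n}$, where $n$ is odd and $32n^2-32n+9$ is a perfect square. (f) $G\cong SD_{8n}$, where $n$ is even and $32n^2-32n+9$ is a perfect square. (g) $G\cong QD_{2^n}$, where $2^{2n-1}-2^{n+2}+9$ is a perfect square.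
   Context: For a finite non-abelian group $G$ with center $Z(G)$, the non-commuting graph $\Gamma_G$ is the simple undirected graph with vertex set $G\setminus Z(G)$ in which $x,y$ are adjacent iff $xy\ne yx$. A finite simple graph $\mathcal G$ with adjacency matrix $A(\mathcal G)$ and diagonal degree matrix $D(\mathcal G)$ is Q-integral if all eigenvalues of its signless Laplacian matrix $Q(\mathcal G)=D(\mathcal G)+A(\mathcal G)$ are integers. The groups are: $D_{2m}=\langle a,b : a^m=b^2=1,\ bab^{-1}=a^{-1}\rangle$ of order $2m$ ($m\ge 3$); $M_{2rs}=\langle a,b : a^r=b^{2s}=1,\ bab^{-1}=a^{-1}\rangle$ of order $2rs$ ($r\ge 3$, $s\ge 1$); $SD_{8n}=\langle a,b : a^{4n}=b^2=1,\ bab^{-1}=a^{2n-1}\rangle$ of order $8n$ ($n>1$); $V_{8n}=\langle a,b : a^{2n}=b^4=1,\ b^{-1}ab^{-1}=bab=a^{-1}\rangle$ of order $8n$ ($n>1$); $Q_{4n}=\langle x,y : x^{2n}=y^4=1,\ x^n=y^2,\ y^{-1}xy=x^{-1}\rangle$ of order $4n$ ($n\ge 2$); $QD_{2^n}=\langle a,b : a^{2^{n-1}}=b^2=1,\ bab^{-1}=a^{2^{n-2}-1}\rangle$ of order $2^n$ ($n\ge 4$). The parameters in the claim satisfy these ranges. *)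

(* Defs.v *)
From HB Require Import structures.
From mathcomp Require Import all_boot all_order all_algebra all_fingroup.
From mathcomp Require Import all_solvable all_field.

Set Implicit Arguments.
Unset Strict Implicit.
Unset Printing Implicit Defensive.

Import GRing.Theory Num.Theory.

Record sgraph := SGraph {
  vertex :> finType;
  adj : rel vertex;
  adj_sym : symmetric adj;
  adj_irrefl : irreflexive adj }.

Section SignlessLaplacian.
Local Open Scope ring_scope.
Variable X : sgraph.

Definition degree (x : X) : nat := #|[pred y | adj x y]|.

(* Rows and columns are indexed by the vertices through [enum_val]. *)
Definition adjacency_mx : 'M[algC]_#|X| :=
  \matrix_(i, j) (adj (enum_val i) (enum_val j))%:R.

Definition degree_mx : 'M[algC]_#|X| :=
  diag_mx (\row_i (degree (enum_val i))%:R).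

Definition signless_laplacian : 'M[algC]_#|X| := degree_mx + adjacency_mx.

(* The entries being integers, every complex eigenvalue lies in [algC]. *)
Definition Q_integral : Prop :=
  forall lambda : algC,
    eigenvalue signless_laplacian lambda -> lambda \is a Num.int.

End SignlessLaplacian.

Section NonCommutingGraph.
Local Open Scope group_scope.
Variables (gT : finGroupType) (G : {group gT}).

Definition nc_vertex : finType := {x : gT | x \in G :\: 'Z(G)}.

Definition nc_adj : rel nc_vertex :=
  fun x y => val x * val y != val y * val x.

Lemma nc_adj_sym : symmetric nc_adj.
Proof. by move=> x y; rewrite /nc_adj eq_sym. Qed.

Lemma nc_adj_irrefl : irreflexive nc_adj.
Proof. by move=> x; rewrite /nc_adj eqxx. Qed.

Definition non_commuting_graph : sgraph := SGraph nc_adj_sym nc_adj_irrefl.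

End NonCommutingGraph.

(* Each [isX] says that the parameters are in the admissible range and that
   the group is isomorphic to X.  The presented groups are all finite, so
   [\isog Grp] is isomorphism with the presented group itself. *)
Section Families.
Local Open Scope group_scope.
Variables (gT : finGroupType) (G : {group gT}).

Definition isD (m : nat) : Prop :=
  (3 <= m)%N /\
  G \isog Grp (a : b : (a ^+ m, b ^+ 2, b * a * b^-1 = a^-1)).

Definition isM (r s : nat) : Prop :=
  (3 <= r)%N /\ (1 <= s)%N /\
  G \isog Grp (a : b : (a ^+ r, b ^+ (2 * s), b * a * b^-1 = a^-1)).

Definition isSD (n : nat) : Prop :=
  (1 < n)%N /\
  G \isog Grp (a : b :
    (a ^+ (4 * n), b ^+ 2, b * a * b^-1 = a ^+ (2 * n - 1))).

Definition isV (n : nat) : Prop :=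
  (1 < n)%N /\
  G \isog Grp (a : b :
    (a ^+ (2 * n), b ^+ 4, b^-1 * a * b^-1 = b * a * b = a^-1)).

Definition isQ (n : nat) : Prop :=
  (2 <= n)%N /\
  G \isog Grp (x : y :
    (x ^+ (2 * n), y ^+ 4, x ^+ n = y ^+ 2, y^-1 * x * y = x^-1)).

Definition isQD (n : nat) : Prop :=
  (4 <= n)%N /\
  G \isog Grp (a : b :
    (a ^+ (2 ^ (n - 1)), b ^+ 2, b * a * b^-1 = a ^+ (2 ^ (n - 2) - 1))).

End Families.

Definition perfect_square (z : int) : Prop := exists k : int, z = (k ^+ 2)%R.

(* Main.v *)
Require Import Defs.
From mathcomp Require Import all_boot all_order all_algebra all_fingroup.
From mathcomp Require Import all_solvable all_field.
From mathcomp Require Import ring zify.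

(* Every group in the statement has an abelian subgroup A of index 2.  Then
   centralizers of non-central elements are abelian, so the non-commuting graph
   is complete multipartite: writing z = |Z(G)| and n = |A : Z(G)|, it has one
   part of size (n - 1)z, namely A minus the center, and n parts of size z.
   A non-integral eigenvalue l of the signless Laplacian then satisfies
   (n - 1)z / (l - z) + nz / (l - 2nz + 3z) = 1, a quadratic equation with
   discriminant z^2 (8n^2 - 16n + 9), so it is an integer if this is a square.
   For the presented groups n = |G'|: the relations show that G' is generated by
   [b, a] and bound |G'| from above, and affine permutations of Z/p satisfying
   the relations bound it from below. *)

Set Implicit Arguments.
Unset Strict Implicit.
Unset Printing Implicit Defensive.

Import GRing.Theory Num.Theory.

Local Open Scope ring_scope.

(** Plays the part of a linear combination tactic: given the multiplier [c], a known equation yields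
    the goal once [ring] or [field] checks the remaining identity. *)
Lemma eq_of_scaled_eq (R : pzRingType) (c l r x y : R) :
  l = r -> x - y = c * (l - r) -> x = y.
Proof. by move=> ->; rewrite subrr mulr0 => /subr0_eq. Qed.

(** * Signless Laplacian spectrum of complete multipartite graphs *)

Section CompleteMultipartite.
Variable X : sgraph.
Hypothesis nadj_trans : transitive (fun x y : X => ~~ adj x y).

Definition part_size (x : X) : nat := #|[pred y | ~~ adj x y]|.

Lemma nadj_part (x y : X) :
  ~~ adj x y -> (fun z => ~~ adj x z) =1 (fun z => ~~ adj y z).
Proof.
move=> nxy z; apply/idP/idP; last exact: nadj_trans.
by apply: nadj_trans; rewrite adj_sym.
Qed.

(** The neighbours of [x] are exactly the vertices outside its part, which gives both the degree and
    the neighbour sum. *)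
Lemma signless_laplacian_row (v : 'rV[algC]_#|X|) (x : X) :
  (v *m signless_laplacian X) 0 (enum_rank x) =
  v 0 (enum_rank x) * (#|X|%:R - (part_size x)%:R)
  + (\sum_y v 0 (enum_rank y) - \sum_(y | ~~ adj x y) v 0 (enum_rank y)).
Proof.
rewrite /signless_laplacian mulmxDr !mxE; congr (_ + _).
  rewrite (bigD1 (enum_rank x)) //= big1 ?addr0; last first.
    by move=> i /negPf nix; rewrite !mxE nix mulr0n mulr0.
  have /esym/(congr1 (fun m : nat => m%:R : algC)) := cardC [pred y | adj x y].
  by rewrite natrD !mxE eqxx mulr1n enum_rankK => ->; rewrite addrK.
rewrite (reindex (@enum_rank X)) /=; last exact: onW_bij (@enum_rank_bij X).
rewrite [in RHS](bigID (fun y => adj x y)) /= addrK [RHS]big_mkcond /=.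
apply: eq_bigr => y _; rewrite mxE !enum_rankK adj_sym.
by case: adj; rewrite ?mulr1 ?mulr0.
Qed.

(* On each part the eigenvector is constant, equal to the sum of all its
   coordinates divided by [lambda - #|X| + 2 * part_size]; now sum over [X]. *)
Lemma multipartite_eigenvalue (lambda : algC) :
  eigenvalue (signless_laplacian X) lambda -> lambda \isn't a Num.int ->
  \sum_(x : X) (lambda - #|X|%:R + 2 * (part_size x)%:R)^-1 = 1.
Proof.
move=> /eigenvalueP[v vQ v_neq0] nint.
pose w x := v 0 (enum_rank x); pose S := \sum_x w x.
(* A vanishing denominator would force [lambda] to be an integer. *)
have nz m : lambda - #|X|%:R + m%:R != 0.
  apply: contraNneq nint => /eqP; rewrite addr_eq0 subr_eq => /eqP ->.
  by rewrite rpredD ?rpredN ?rpred_nat.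
have eqw x : (lambda - #|X|%:R + (part_size x)%:R) * w x =
             S - \sum_(y | ~~ adj x y) w y.
  move/rowP/(_ (enum_rank x)): vQ; rewrite signless_laplacian_row mxE.
  by rewrite -/(w x) -/S => /(@eq_of_scaled_eq _ (- 1)); apply; ring.
(* Vertices of one part satisfy [eqw] with the same nonzero coefficient and the same right-hand
   side. *)
have wconst x y : ~~ adj x y -> w y = w x.
  move=> nxy; apply: (mulfI (nz (part_size x))); rewrite eqw.
  rewrite /part_size (eq_card (nadj_part nxy)) -/(part_size y) eqw.
  by congr (_ - _); apply: eq_bigl => z; rewrite (nadj_part nxy).
have eqw2 x : (lambda - #|X|%:R + 2 * (part_size x)%:R) * w x = S.
  have sumP : \sum_(y | ~~ adj x y) w y = (part_size x)%:R * w x.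
    rewrite mulr_natl -sumr_const /=; apply: eq_big => [y | y /wconst //].
    by rewrite inE.
  by have := eqw x; rewrite sumP => /(@eq_of_scaled_eq _ 1); apply; ring.
have nz2 x : lambda - #|X|%:R + 2 * (part_size x)%:R != 0.
  by rewrite -natrM.
have S_neq0 : S != 0.
  apply: contraNneq v_neq0 => S0; apply/eqP/rowP => i; rewrite mxE.
  apply/(mulfI (nz2 (enum_val i))); rewrite mulr0 -S0 -(eqw2 (enum_val i)).
  by rewrite /w enum_valK.
apply: (mulIf S_neq0); rewrite mul1r mulr_suml; apply: eq_bigr => x _.
by rewrite -(eqw2 x) mulKf.
Qed.

End CompleteMultipartite.

(** The roots are (4n - 3 + s)z / 2 with s = k or s = -k. The discriminant is odd, hence so is s,
    and 4n - 3 + s is even. *)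
Lemma quadratic_int (z n : nat) (k : int) (lambda : algC) :
  8 * n%:Z ^+ 2 - 16 * n%:Z + 9 = k ^+ 2 ->
  (2 * lambda - (4 * n%:R - 3) * z%:R) ^+ 2 = (k%:~R * z%:R) ^+ 2 ->
  lambda \is a Num.int.
Proof.
move=> disc /eqP; rewrite eqf_sqr.
suff oddk (s : int) : s ^+ 2 = k ^+ 2 ->
    2 * lambda - (4 * n%:R - 3) * z%:R = s%:~R * z%:R -> lambda \is a Num.int.
  case/orP => /eqP; first exact: oddk.
  by rewrite -[- (k%:~R * _)]mulNr -mulrNz; apply: oddk; rewrite sqrrN.
rewrite -disc => oddk E.
have [m ms] : exists m : int, 4 * n%:Z - 3 + s = 2 * m.
  have [t st] : exists t, s = 2 * t \/ s = 2 * t + 1.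
    by exists (s %/ 2)%Z; lia.
  case: st oddk => -> oddk; last by exists (2 * n%:Z - 1 + t); ring.
  by move: oddk; rewrite exprMn; move: (t ^+ 2) (n%:Z ^+ 2) => u v; lia.
have -> : lambda = m%:~R * z%:R; last by rewrite rpredM ?rpred_int ?rpred_nat.
have /(congr1 (fun i : int => i%:~R : algC)) := ms.
rewrite !rmorphD rmorphN !rmorphM /= => ms'.
apply: (@mulfI _ (2 : algC)); first by rewrite pnatr_eq0.
by apply: (@eq_of_scaled_eq _ 1 _ _ _ _ E); rewrite mulrA -ms'; ring.
Qed.

Local Close Scope ring_scope.
Local Open Scope group_scope.

(** * Non-commuting graphs of groups with an abelian subgroup of index 2 *)

Lemma center_sub_subcent1 (gT : finGroupType) (G : {group gT}) x :
  x \in G -> 'Z(G) \subset 'C_G[x].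
Proof. by move=> Gx; rewrite setIS // -cent_set1 centS ?sub1set. Qed.

Section AbelianIndex2.
Variables (gT : finGroupType) (G A : {group gT}).
Hypotheses (sAG : A \subset G) (cAA : abelian A) (iGA : #|G : A| = 2).
Hypothesis nabG : ~~ abelian G.

Lemma mem_divl_index2 x y : x \in G :\: A -> y \in G :\: A -> x^-1 * y \in A.
Proof.
move=> xGA yGA; have yVGA : y^-1 \in G :\: A by rewrite inE !groupV -in_setD.
rewrite -{1}[y]invgK -mem_rcoset (rcoset_index2 sAG iGA yVGA).
by rewrite inE !groupV -in_setD.
Qed.

(** Every element of [G] outside [A] is [y] times an element of the abelian group [A]. *)
Lemma center_of_commute_index2 x y :
  x \in A -> y \in G :\: A -> commute x y -> x \in 'Z(G).
Proof.
move=> Ax yGA cxy; apply/centerP; split=> [|w Gw]; first exact: subsetP Ax.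
have [Aw | nAw] := boolP (w \in A); first exact: (centsP cAA).
rewrite -(mulKVg y w); apply: commuteM => //; apply: (centsP cAA) => //.
by apply: mem_divl_index2 => //; rewrite inE nAw.
Qed.

(** A central element outside [A] would make all of [A] central, and then [G] abelian. *)
Lemma center_sub_index2 : 'Z(G) \subset A.
Proof.
apply/subsetP => z Zz; apply: contraR nabG => nAz.
have [Gz cz] := centerP _ _ Zz; have zGA : z \in G :\: A by rewrite inE nAz.
have sAZ x : x \in A -> x \in 'Z(G).
  move=> Ax; apply: (center_of_commute_index2 Ax zGA).
  exact/commute_sym/cz/(subsetP sAG).
suff sGZ : G \subset 'Z(G) by apply: subset_trans sGZ (subsetIr _ _).
apply/subsetP => x Gx; have [/sAZ // | nAx] := boolP (x \in A).
rewrite -(mulKVg z x) groupM // sAZ //.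
by apply: mem_divl_index2 => //; rewrite inE nAx.
Qed.

Lemma subcent1_index2_in x : x \in A -> x \notin 'Z(G) -> 'C_G[x] = A.
Proof.
move=> Ax nZx; apply/eqP; rewrite eqEsubset subsetI sAG sub_cent1 /=.
rewrite (subsetP cAA) // andbT.
apply/subsetP => y /setIP[Gy /cent1P cxy]; apply: contraR nZx => nAy.
by apply: (center_of_commute_index2 Ax _ (commute_sym cxy)); rewrite inE nAy.
Qed.

Lemma subcent1_index2_out x : x \in G :\: A -> 'C_A[x] = 'Z(G).
Proof.
move=> xGA; have [Gx _] := setDP xGA.
apply/eqP; rewrite eqEsubset subsetI center_sub_index2 /=; apply/andP; split.
  apply/subsetP => y /setIP[Ay /cent1P cxy].
  exact: (center_of_commute_index2 Ay xGA cxy).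
by apply: subset_trans (center_sub_subcent1 Gx) (subsetIr _ _).
Qed.

(** An element of the centralizer outside [A] differs from [x] by an element of ['C_A[x]], so the
    centralizer is the disjoint union of the center and its coset by [x]. *)
Lemma card_subcent1_index2_out x :
  x \in G :\: A -> #|'C_G[x]| = (2 * #|'Z(G)|)%N.
Proof.
move=> xGA; have [Gx nAx] := setDP xGA.
rewrite -(cardsID A 'C_G[x]) setIAC (setIidPr sAG) subcent1_index2_out //.
rewrite mul2n -addnn; congr (_ + _)%N.
suff -> : 'C_G[x] :\: A = x *: 'Z(G) by rewrite card_lcoset.
apply/setP => y; rewrite mem_lcoset -(subcent1_index2_out xGA) in_setD !in_setI.
have cx : x^-1 \in 'C[x] by rewrite groupV cent1id.
rewrite (groupMl _ cx); case: (y \in 'C[x]); rewrite ?andbF // !andbT.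
apply/andP/idP => [[nAy Gy] | Axy].
  by rewrite mem_divl_index2 // inE nAy.
have Gy : y \in G by rewrite -(mulKVg x y) groupM // (subsetP sAG).
by split=> //; apply: contra nAx => Ay; rewrite -groupV -(groupMr _ Ay).
Qed.

(** Outside [A], the centralizer has a central subgroup of index 2, hence a cyclic central
    quotient. *)
Lemma abelian_subcent1_index2 x :
  x \in G -> x \notin 'Z(G) -> abelian 'C_G[x].
Proof.
move=> Gx nZx; have [Ax | nAx] := boolP (x \in A).
  by rewrite subcent1_index2_in.
have xGA : x \in G :\: A by rewrite inE nAx.
have sZC := center_sub_subcent1 Gx.
have sZZ : 'Z(G) \subset 'Z('C_G[x]).
  by rewrite subsetI sZC subIset // centS ?orbT ?subsetIl.
apply: (cyclic_factor_abelian sZZ); apply: prime_cyclic.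
rewrite card_quotient; last exact/normal_norm/sub_center_normal.
by rewrite -divgS // card_subcent1_index2_out // mulnK.
Qed.

Local Notation X := (non_commuting_graph G).

Lemma nc_adjE (x y : X) : ~~ adj x y = (val y \in 'C_G[val x]).
Proof.
have /setDP[Gy _] := valP y; rewrite inE Gy /=.
by apply/negPn/cent1P => [/eqP | ->].
Qed.

(** Two elements commuting with a non-central [y] lie in its abelian centralizer. *)
Lemma nc_nadj_trans : transitive (fun x y : X => ~~ adj x y).
Proof.
move=> y x w; rewrite !nc_adjE => Cxy Cyw.
have /setDP[Gy nZy] := valP y; have /setDP[Gw _] := valP w.
have cCy := abelian_subcent1_index2 Gy nZy.
have /setDP[Gx nZx] := valP x.
rewrite inE Gw; apply/cent1P; apply: (centsP cCy) => //.
by rewrite inE Gx cent1C; case/setIP: Cxy.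
Qed.

Lemma card_nc_vertex (B : {set gT}) : B \subset G ->
  #|[pred x : X | val x \in B]| = #|B :\: 'Z(G)|.
Proof.
move=> sBG; rewrite -(card_imset _ val_inj); apply: eq_card => y.
apply/imsetP/setDP => [[x xB ->] | [By nZy]].
  by have /setDP[_ nZx] := valP x.
have yGZ : y \in G :\: 'Z(G) by rewrite inE nZy (subsetP sBG).
by exists (Sub y yGZ); rewrite ?inE SubK.
Qed.

Lemma card_nc : #|X| = (2 * #|A| - #|'Z(G)|)%N.
Proof.
rewrite mulnC -iGA Lagrange // -cardsDS ?center_sub // -card_nc_vertex //.
by apply/esym/eq_card => x; rewrite !inE; case/setDP: (valP x).
Qed.

Lemma part_size_nc (x : X) : part_size x =
  if val x \in A then (#|A| - #|'Z(G)|)%N else #|'Z(G)|.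
Proof.
have /setDP[Gx nZx] := valP x.
transitivity #|'C_G[val x] :\: 'Z(G)|.
  rewrite -card_nc_vertex ?subsetIl //; apply: eq_card => y.
  by rewrite inE nc_adjE.
case: ifP => [Ax | /negbT nAx].
  by rewrite subcent1_index2_in // cardsDS ?center_sub_index2.
have xGA : val x \in G :\: A by rewrite inE nAx.
rewrite cardsDS ?center_sub_subcent1 // card_subcent1_index2_out //.
by rewrite mul2n -addnn addnK.
Qed.

End AbelianIndex2.

(** The graph has no vertex, so the matrix is empty and has no eigenvector. *)
Lemma Q_integral_abelian (gT : finGroupType) (G : {group gT}) :
  abelian G -> Q_integral (non_commuting_graph G).
Proof.
move=> abG lambda /eigenvalueP[v _ /eqP[]]; apply/rowP => i.
have /setDP[Gx /negP[]] := valP (enum_val i).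
by rewrite inE Gx; apply: subsetP abG _ Gx.
Qed.

Lemma Q_integral_abelian_index2 (gT : finGroupType) (G A : {group gT}) n :
  A \subset G -> abelian A -> #|G : A| = 2 -> #|A : 'Z(G)| = n ->
  perfect_square (8 * n%:Z ^+ 2 - 16 * n%:Z + 9) ->
  Q_integral (non_commuting_graph G).
Proof.
move=> sAG cAA iGA iAZ [k disc] lambda eigl.
have [abG | nabG] := boolP (abelian G); first exact: Q_integral_abelian eigl.
have sZA := center_sub_index2 sAG cAA iGA nabG.
have oA : #|A| = (n * #|'Z(G)|)%N by rewrite -(Lagrange sZA) iAZ mulnC.
have [// | nint] := boolP (lambda \is a Num.int); set z := #|'Z(G)| in oA *.
have nz (i : int) : (lambda - i%:~R != 0)%R.
  by apply: contraNneq nint => /subr0_eq->; apply: rpred_int.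
(* The case split left [false] as the goal. Restoring integrality as the goal allows a direct proof,
   while [nint] keeps the denominators nonzero. *)
rewrite -(negbTE nint).
apply: (@quadratic_int z n k lambda disc).
have := multipartite_eigenvalue (nc_nadj_trans sAG cAA iGA nabG) eigl nint.
rewrite (bigID (fun x => val x \in A)) /=.
have z_gt0 : (0 < z)%N by apply: cardG_gt0.
have zA : (z <= #|A|)%N by apply: subset_leq_card.
have z2A : (z <= 2 * #|A|)%N by lia.
rewrite (eq_bigr (fun=> ((lambda - z%:R)^-1)%R)); last first.
  move=> x Ax; rewrite (part_size_nc sAG cAA iGA nabG) Ax (card_nc sAG iGA).
  rewrite !natrB //.
  by congr (_^-1)%R; rewrite natrM; ring.
rewrite sumr_const.
rewrite (eq_bigr (fun=> ((lambda - 2 * #|A|%:R + 3 * z%:R)^-1)%R)); last first.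
  move=> x /negPf nAx.
  rewrite (part_size_nc sAG cAA iGA nabG) nAx (card_nc sAG iGA).
  rewrite !natrB //.
  by congr (_^-1)%R; rewrite natrM; ring.
rewrite sumr_const (card_nc_vertex sAG) cardsDS //.
set nA := [pred x : non_commuting_graph G | val x \notin A].
(* The center lies in [A], so every element of [G] outside [A] is a vertex. *)
have -> : #|nA| = #|A|.
  have := cardC [pred x : non_commuting_graph G | val x \in A].
  rewrite card_nc_vertex // cardsDS // (card_nc sAG iGA) -/z.
  rewrite [X in (_ + X)%N](_ : _ = #|nA|) //.
  by rewrite mul2n -addnn -addnBAC // => /addnI.
have := congr1 (fun i : int => i%:~R%R : algC) disc.
rewrite !rmorphD rmorphN !rmorphM /= => disc'.
have := nz z; have := nz (2 * (n%:Z * z%:Z) - 3 * z%:Z)%R.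
rewrite rmorphB !rmorphM /= opprD opprK addrA => nz2 nz1.
rewrite -[(_^-1 *+ (#|A| - _))%R]mulr_natr -[(_^-1 *+ #|A|)%R]mulr_natr.
rewrite natrB // oA natrM.
(* Clearing the denominators with factor -4 and completing the square gives the equation required by
   [quadratic_int]. *)
pose d := ((lambda - z%:R) * (lambda - 2 * (n%:R * z%:R) + 3 * z%:R))%R.
move=> /(@eq_of_scaled_eq _ (- 4 * d)%R); apply.
rewrite [in RHS]/d exprMn [X in (_ - X * _)%R]expr2 -disc'.
by field; apply/andP; split.
Qed.

(** * Groups generated by [a] and [b] where [b ^+ 2] commutes with [a] *)

Section TwoGenerators.
Variables (gT : finGroupType) (a b : gT).
Local Notation A := <<[set a; b ^+ 2]>>.
Local Notation G := <<[set a; b]>>.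
Local Notation c := [~ b, a].
Hypotheses (cab2 : commute a (b ^+ 2)) (Aab : a ^ b \in A).

Let Aa : a \in A. Proof. by rewrite mem_gen // set21. Qed.
Let Ab2 : b ^+ 2 \in A. Proof. by rewrite mem_gen // set22. Qed.
Let Ga : a \in G. Proof. by rewrite mem_gen // set21. Qed.
Let Gb : b \in G. Proof. by rewrite mem_gen // set22. Qed.

Let sAG : A \subset G.
Proof. by rewrite gen_subG subUset !sub1set Ga groupX. Qed.

Lemma abelian_gen_square : abelian A.
Proof.
rewrite abelian_gen; apply/centsP => x /set2P[] -> y /set2P[] -> //.
Qed.

Let nAb : b \in 'N(A).
Proof.
rewrite inE -genJ gen_subG conjUg !conjg_set1 subUset !sub1set Aab.
by rewrite conjXg conjgE mulKg.
Qed.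

Let comm_eq : c = (a ^ b)^-1 * a.
Proof. by rewrite commgEr conjVg. Qed.

Let Ac : c \in A.
Proof. by rewrite comm_eq groupM ?groupV. Qed.

(** Since [b ^+ 2] centralizes [a], conjugation by [b] swaps [a] and [a ^ b]. *)
Let conj_comm : c ^ b = c^-1.
Proof.
rewrite comm_eq conjMg conjVg -conjgM -expg2 [a ^ (b ^+ 2)](_ : _ = a).
  by rewrite invMg invgK.
by apply/conjg_fixP/commgP.
Qed.

Let G_join : G = A <*> <[b]>.
Proof.
apply/eqP; rewrite eqEsubset; apply/andP; split; last first.
  by rewrite join_subG sAG cycle_subG.
rewrite gen_subG subUset !sub1set mem_gen ?inE ?Aa //=.
by rewrite mem_gen ?inE ?cycle_id ?orbT.
Qed.

Lemma index2_of_commute_square : b \notin A -> #|G : A| = 2.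
Proof.
move=> nAb'; have sGN : G \subset 'N(A).
  by rewrite G_join join_subG normG cycle_subG.
rewrite -card_quotient // G_join quotientYidl ?cycle_subG //.
rewrite quotient_cycle // -orderE.
apply: nt_prime_order => //; first by rewrite -[RHS](coset_id Ab2) morphX.
by apply: contra nAb' => /eqP/(coset_idr nAb).
Qed.

(** The cycle of [c] is normal, as [a] centralizes [c] and [b] inverts it; modulo this cycle the
    generators commute. *)
Lemma der1_of_commute_square : G^`(1) = <[c]>.
Proof.
apply/eqP; rewrite eqEsubset cycle_subG mem_commg // andbT.
have nGc : G \subset 'N(<[c]>).
  rewrite gen_subG subUset !sub1set; apply/andP; split; last first.
    by rewrite inE -cycleJ conj_comm cycleV.
  rewrite inE -cycleJ [c ^ a](_ : _ = c) //.
  exact/conjg_fixP/commgP/(centsP abelian_gen_square).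
apply: der1_min => //; rewrite quotient_gen //; last first.
  exact: subset_trans (subset_gen _) nGc.
have nac := subsetP nGc _ Ga; have nbc := subsetP nGc _ Gb.
have cab : commute (coset <[c]> b) (coset <[c]> a).
  by apply/commgP/eqP; rewrite -morphR //; apply/coset_id/cycle_id.
rewrite abelian_gen quotientU !quotient_set1 //.
by apply/centsP => x /set2P[] -> y /set2P[] ->.
Qed.

Lemma conj_commg_expg i : b ^ (a ^+ i) = b * c ^+ i.
Proof.
by rewrite conjg_mulR commgX //; apply: (centsP abelian_gen_square).
Qed.

Lemma abelian_gen_of_mem : b \in A -> abelian G.
Proof.
move=> Ab; apply: abelianS abelian_gen_square.
by rewrite gen_subG subUset !sub1set Aa.
Qed.

(** The center is the centralizer of [b] in [A], so the index counts the [A]-conjugates of [b].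
    Powers of [b ^+ 2] fix [b], and conjugating by powers of [a] sweeps out the coset of the cycle
    of [c] by [b]. *)
Lemma index_center_of_commute_square :
  ~~ abelian G -> #|A : 'Z(G)| = #[c].
Proof.
move=> nabG; have nAb' : b \notin A.
  by apply: contra nabG; apply: abelian_gen_of_mem.
have iGA := index2_of_commute_square nAb'.
have bGA : b \in G :\: A by rewrite inE nAb'.
rewrite -(subcent1_index2_out sAG abelian_gen_square iGA nabG bGA).
rewrite index_cent1 orderE -(card_lcoset <[c]> b); apply: eq_card => y.
have defA : A = <[a]> * <[b ^+ 2]>.
  rewrite -cent_joinEl; first by rewrite joing_idl joing_idr.
  by rewrite cycle_subG; apply/centP => _ /cycleP[i ->]; apply: commuteX.
apply/imsetP/lcosetP => [[x] | [_ /cycleP[i ->] ->]]; last first.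
  by exists (a ^+ i); rewrite ?groupX // conj_commg_expg.
move=> Ax; have: x \in <[a]> * <[b ^+ 2]> by rewrite -defA.
case/mulsgP=> _ _ /cycleP[i ->] /cycleP[j ->] -> ->.
exists (c ^+ i); first exact: mem_cycle.
rewrite conjgM conj_commg_expg; apply/conjg_fixP/commgP.
apply: commute_sym; apply: commuteM; last first.
  by apply: (centsP abelian_gen_square); rewrite groupX.
by rewrite -expgM; apply/commute_sym/commuteX.
Qed.

End TwoGenerators.

(** Common criterion for the presented groups: the last two conditions before the square bound the
    order of the commutator from above and below, so that it equals [n]. The lower bound is stated
    through the derived subgroup, which is independent of the generators. *)
Lemma Q_integral_of_commute_square (gT : finGroupType) (G : {group gT}) a b n :
  G :=: <<[set a; b]>> -> commute a (b ^+ 2) -> a ^ b \in <<[set a; b ^+ 2]>> ->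
  [~ b, a] ^+ n = 1 -> n %| #|G^`(1)| ->
  perfect_square (8 * n%:Z ^+ 2 - 16 * n%:Z + 9) ->
  Q_integral (non_commuting_graph G).
Proof.
move=> defG cab2 Aab cn1.
have -> : G = [group of <<[set a; b]>>] by apply: val_inj.
rewrite der1_of_commute_square // -orderE => n_dv sq.
have oc : #[[~ b, a]] = n.
  by apply/eqP; rewrite eqn_dvd n_dv order_dvdn cn1 eqxx.
have [abG | nabG] := boolP (abelian <<[set a; b]>>).
  exact: Q_integral_abelian.
apply: (@Q_integral_abelian_index2 _ _ [group of <<[set a; b ^+ 2]>>]) sq.
- by rewrite gen_subG subUset !sub1set groupX ?mem_gen ?set21 ?set22.
- exact: abelian_gen_square.
- apply: index2_of_commute_square => //.
  by apply: contra nabG; apply: abelian_gen_of_mem.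
by rewrite index_center_of_commute_square.
Qed.

(** * Affine models and lower bounds for the derived subgroup *)

Lemma affine_perms p e : 1 < p -> (e * e = 1 %[mod p])%N ->
  exists x y : {perm 'Z_p}, [/\ #[x] = p, y ^+ 2 = 1 & x ^ y = x ^+ e].
Proof.
move=> p_gt1 e2; have e2p : (e%:R * e%:R = 1 :> 'Z_p)%R.
  by rewrite -natrM; apply: val_inj; rewrite /= !val_Zp_nat // e2 -val_Zp_nat.
(* The model consists of the translation by 1 and of the multiplication by [e], an involution or the
   identity because e^2 = 1 modulo p. *)
pose x := perm (addIr 1%R : injective (fun i : 'Z_p => i + 1)%R).
have mul_inj : injective (fun i : 'Z_p => e%:R * i)%R.
  by apply: (can_inj (g := fun i => e%:R * i)%R) => i; rewrite mulrA e2p mul1r.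
pose y := perm mul_inj.
have xE k i : (x ^+ k) i = (i + k%:R)%R.
  elim: k i => [|k IH] i; first by rewrite perm1 addr0.
  by rewrite expgSr permM IH permE -addrA natr1.
have y2 : y ^+ 2 = 1.
  by apply/permP => i; rewrite permM !permE mulrA e2p mul1r.
exists x, y; split=> //.
  have xk k : (x ^+ k == 1) = (p %| k).
    apply/eqP/idP => [/permP/(_ 0%R) | /dvdnP[m ->]].
      rewrite xE perm1 add0r => /(congr1 val); rewrite /= val_Zp_nat //.
      by move=> /eqP.
    by apply/permP => i; rewrite xE perm1 natrM pchar_Zp // mulr0 addr0.
  by apply/eqP; rewrite eqn_dvd order_dvdn xk dvdnn -xk expg_order eqxx.
have yV : y^-1 = y by apply: (mulgI y); rewrite mulgV -expg2 y2.
apply/permP => i; rewrite conjgE yV !permM xE !permE.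
by rewrite mulrDr mulrA e2p mul1r mulr1.
Qed.

(** A surjective homomorphism maps the derived subgroup onto the derived subgroup. *)
Lemma dvdn_order_commg_der1 (gT rT : finGroupType) (G : {group gT})
    (H : {group rT}) x y :
  H \homg G -> x \in H -> y \in H -> #[[~ y, x]] %| #|G^`(1)|.
Proof.
case/homgP=> f defH Hx Hy; apply: dvdn_trans (dvdn_morphim f [group of G^`(1)]).
by rewrite morphim_der // defH order_dvdG ?mem_commg.
Qed.

Lemma commg_of_conjX (gT : finGroupType) (x y : gT) e :
  0 < e -> x ^ y = x ^+ e -> [~ y, x] = x ^- e.-1.
Proof.
move=> e_gt0 xy; rewrite commgEr conjVg xy -[in LHS](prednK e_gt0) expgS.
by rewrite invMg mulgKV.
Qed.

Lemma model_commg p e : 1 < p -> 0 < e -> (e * e = 1 %[mod p])%N ->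
  exists rT : finGroupType, exists x y : rT,
    [/\ #[x] = p, y ^+ 2 = 1, x ^ y = x ^+ e
      & #[[~ y, x]] = (p %/ gcdn p e.-1)%N].
Proof.
move=> p_gt1 e_gt0 /(affine_perms p_gt1)[x [y [ox y2 xy]]].
exists {perm 'Z_p}, x, y; split=> //.
by rewrite (commg_of_conjX e_gt0 xy) orderV orderXgcd ox.
Qed.

Lemma invg_of_square1 (gT : finGroupType) (y : gT) : y ^+ 2 = 1 -> y^-1 = y.
Proof. by move=> y2; apply: (mulgI y); rewrite mulgV -expg2 y2. Qed.

(* An isomorphism with the presented group need not match generators, so
   a model of the relations only bounds invariants of [G]: here [#|G^`(1)|]. *)
Section Families.
Variables (gT : finGroupType) (G : {group gT}).

(** Models with y^2 = 1 satisfy the relation on b^(2s) whatever [s] is. *)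
Lemma isM_gens r s : isM G r s ->
  (exists a b, [/\ G :=: <<[set a; b]>>, a ^+ r = 1 & b * a * b^-1 = a^-1]) /\
  (forall (rT : finGroupType) (x y : rT), x ^+ r = 1 -> y ^+ 2 = 1 ->
     x ^ y = x^-1 -> #[[~ y, x]] %| #|G^`(1)|).
Proof.
case=> [_ [_ isoG]]; split.
  have /existsP[[a b] /=] := isoGrp_hom isoG.
  rewrite !xpair_eqE => /and4P[/eqP defG /eqP ar _ /eqP ba].
  by exists a, b; split=> //; rewrite -defG joing_idl joing_idr.
move=> rT x y xr y2 xy.
have hom : [group of <[x]> <*> <[y]>] \homg G.
  rewrite isoG; apply/existsP; exists (x, y); rewrite /= !xpair_eqE.
  apply/and4P; split; rewrite ?xr //; first by rewrite expgM y2 expg1n.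
  by rewrite -xy conjgE invg_of_square1 ?mulgA.
by apply: (dvdn_order_commg_der1 hom); rewrite mem_gen ?inE ?cycle_id ?orbT.
Qed.

Lemma isSD_gens n : isSD G n ->
  (exists a b, [/\ G :=: <<[set a; b]>>, a ^+ (4 * n) = 1, b ^+ 2 = 1
     & b * a * b^-1 = a ^+ (2 * n - 1)]) /\
  (forall (rT : finGroupType) (x y : rT), x ^+ (4 * n) = 1 -> y ^+ 2 = 1 ->
     x ^ y = x ^+ (2 * n - 1) -> #[[~ y, x]] %| #|G^`(1)|).
Proof.
case=> [_ isoG]; split.
  have /existsP[[a b] /=] := isoGrp_hom isoG.
  rewrite !xpair_eqE => /and4P[/eqP defG /eqP ar /eqP b2 /eqP ba].
  by exists a, b; split=> //; rewrite -defG joing_idl joing_idr.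
move=> rT x y xr y2 xy.
have hom : [group of <[x]> <*> <[y]>] \homg G.
  rewrite isoG; apply/existsP; exists (x, y); rewrite /= !xpair_eqE.
  apply/and4P; split; rewrite ?xr ?y2 //.
  by rewrite -xy conjgE invg_of_square1 ?mulgA.
by apply: (dvdn_order_commg_der1 hom); rewrite mem_gen ?inE ?cycle_id ?orbT.
Qed.

Lemma isV_gens n : isV G n ->
  (exists a b, [/\ G :=: <<[set a; b]>>, a ^+ (2 * n) = 1, b ^+ 4 = 1,
     b^-1 * a * b^-1 = a^-1 & b * a * b = a^-1]) /\
  (forall (rT : finGroupType) (x y : rT), x ^+ (2 * n) = 1 -> y ^+ 4 = 1 ->
     y^-1 * x * y^-1 = x^-1 -> y * x * y = x^-1 -> #[[~ y, x]] %| #|G^`(1)|).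
Proof.
case=> [_ isoG]; split.
  have /existsP[[a b] /=] := isoGrp_hom isoG.
  rewrite !xpair_eqE => /and5P[/eqP defG /eqP ar /eqP b4 /eqP ba /eqP ba'].
  by exists a, b; split=> //; rewrite -defG joing_idl joing_idr.
move=> rT x y xr y4 xy xy'.
have hom : [group of <[x]> <*> <[y]>] \homg G.
  rewrite isoG; apply/existsP; exists (x, y); rewrite /= !xpair_eqE.
  by rewrite xr y4 xy xy' !eqxx.
by apply: (dvdn_order_commg_der1 hom); rewrite mem_gen ?inE ?cycle_id ?orbT.
Qed.

Lemma isQ_gens n : isQ G n ->
  (exists a b, [/\ G :=: <<[set a; b]>>, a ^+ (2 * n) = 1,
     a ^+ n = b ^+ 2 & b^-1 * a * b = a^-1]) /\
  (forall (rT : finGroupType) (x y : rT), x ^+ (2 * n) = 1 ->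
     x ^+ n = y ^+ 2 -> x ^ y = x^-1 -> #[[~ y, x]] %| #|G^`(1)|).
Proof.
case=> [_ isoG]; split.
  have /existsP[[a b] /=] := isoGrp_hom isoG.
  rewrite !xpair_eqE => /and5P[/eqP defG /eqP ar _ /eqP an /eqP ba].
  by exists a, b; split=> //; rewrite -defG joing_idl joing_idr.
move=> rT x y xr xn xy.
have hom : [group of <[x]> <*> <[y]>] \homg G.
  rewrite isoG; apply/existsP; exists (x, y); rewrite /= !xpair_eqE.
  by rewrite xr (expgM y 2 2) -xn -expgM mulnC xr -mulgA -conjgE xy !eqxx.
by apply: (dvdn_order_commg_der1 hom); rewrite mem_gen ?inE ?cycle_id ?orbT.
Qed.

End Families.

(** * Q-integrality of the presented families *)

Lemma Q_integral_M (gT : finGroupType) (G : {group gT}) r s n :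
  isM G r s -> n = (r %/ gcdn r 2)%N ->
  perfect_square (8 * n%:Z ^+ 2 - 16 * n%:Z + 9) ->
  Q_integral (non_commuting_graph G).
Proof.
move=> isMG n_eq sq; have [r_ge3 _] := isMG.
have [[a [b [defG ar ba]]] lower] := isM_gens isMG.
have aVb : a ^ b^-1 = a^-1 by rewrite conjgE invgK mulgA.
have ab : a ^ b = a^-1 by rewrite -[a in RHS](conjgKV b) aVb conjVg invgK.
apply: (Q_integral_of_commute_square defG) sq.
- by apply/commgP/conjg_fixP; rewrite expg2 conjgM ab conjVg ab invgK.
- by rewrite ab groupV mem_gen ?set21.
(* The commutator is a^2, whose order divides r / gcd(r, 2). *)
- rewrite commgEr conjVg ab invgK -expg2 -expgM n_eq gcdnC muln_divCA_gcd.
  by rewrite expgM ar expg1n.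
have [k rk] : exists k, r = k.+2 by exists r.-2; lia.
(* Multiplication by r - 1 is inversion modulo r; its square is (r - 2)r + 1. *)
have [|||rT [x [y [ox y2 xy oxy]]]] := @model_commg r r.-1; try lia.
  by rewrite rk /= -(modnMDl k 1); congr (_ %% _); lia.
have -> : n = (r %/ gcdn r r.-1.-1)%N.
  rewrite n_eq rk /= -(addn2 k) ![gcdn (k + 2) _]gcdnC.
  by rewrite gcdnDr gcdnDl (gcdnC 2).
rewrite -oxy; apply: lower => //; first by rewrite -ox expg_order.
apply: (mulgI x); rewrite xy -expgS prednK ?mulgV; last by lia.
by rewrite -ox expg_order.
Qed.

Lemma semidihedral_model n : 1 < n ->
  exists rT : finGroupType, exists x y : rT,
    [/\ #[x] = (4 * n)%N, y ^+ 2 = 1, x ^ y = x ^+ (2 * n - 1)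
      & #[[~ y, x]] = (4 * n %/ gcdn (4 * n) (2 * n - 2))%N].
Proof.
move=> n_gt1; have -> : (2 * n - 2 = (2 * n - 1).-1)%N by lia.
apply: model_commg; try lia.
(* Here (2n - 1)^2 = (n - 1)4n + 1. *)
rewrite -(modnMDl n.-1 1); congr (_ %% _).
by case: n n_gt1 => // n _; rewrite mulnS /=; lia.
Qed.

Lemma Q_integral_SD (gT : finGroupType) (G : {group gT}) m n :
  isSD G m -> n = (4 * m %/ gcdn (4 * m) (2 * m - 2))%N ->
  perfect_square (8 * n%:Z ^+ 2 - 16 * n%:Z + 9) ->
  Q_integral (non_commuting_graph G).
Proof.
move=> isSDG n_eq sq; have [m_gt1 _] := isSDG.
have [[a [b [defG ar b2 ba]]] lower] := isSD_gens isSDG.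
have ab : a ^ b = a ^+ (2 * m - 1).
  by rewrite -ba conjgE invg_of_square1 // mulgA.
have e_gt0 : 0 < 2 * m - 1 by lia.
apply: (Q_integral_of_commute_square defG) sq.
- by rewrite b2; apply: commute1.
- by rewrite ab groupX // mem_gen ?set21.
- rewrite (commg_of_conjX e_gt0 ab) expVgn -expgM n_eq.
  have -> : ((2 * m - 1).-1 = 2 * m - 2)%N by lia.
  by rewrite gcdnC muln_divCA_gcd expgM ar expg1n invg1.
have [rT [x [y [ox y2 xy oxy]]]] := semidihedral_model m_gt1.
by rewrite n_eq -oxy; apply: lower => //; rewrite -ox expg_order.
Qed.

(* The model of Q_4n is the subgroup <x^2, xy> of SD_8n. *)
Lemma Q_integral_Q (gT : finGroupType) (G : {group gT}) n :
  isQ G n -> perfect_square (8 * n%:Z ^+ 2 - 16 * n%:Z + 9) ->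
  Q_integral (non_commuting_graph G).
Proof.
move=> isQG sq; have [n_gt1 _] := isQG.
have [[a [b [defG ar an ba]]] lower] := isQ_gens isQG.
have ab : a ^ b = a^-1 by rewrite conjgE mulgA.
apply: (Q_integral_of_commute_square defG) sq.
- by rewrite -an; apply: commuteX.
- by rewrite ab groupV mem_gen ?set21.
- by rewrite commgEr conjVg ab invgK -expg2 -expgM ar.
have [rT [x [y [ox y2 xy _]]]] := semidihedral_model n_gt1.
have x4n : x ^+ (4 * n) = 1 by rewrite -ox expg_order.
have uv : (x ^+ 2) ^ (x * y) = (x ^+ 2)^-1.
  rewrite conjgM conjXg [x ^ x]conjgE mulKg conjXg xy.
  apply: (mulIg (x ^+ 2)); rewrite mulVg -expgM -expgD -[RHS]x4n.
  by congr (_ ^+ _); lia.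
have v2 : (x ^+ 2) ^+ n = (x * y) ^+ 2.
  (* As y^2 = 1, the square of xy is x times its conjugate by y, that is x^(2n). *)
  transitivity (x * x ^ y); last first.
    by rewrite conjgE invg_of_square1 // expg2 !mulgA.
  by rewrite xy -expgM -expgS; congr (_ ^+ _); lia.
have := lower _ _ _ _ v2 uv; rewrite -expgM mulnA x4n => /(_ erefl).
(* The commutator is x^4, of order 4n / 4 = n. *)
rewrite commgEr conjVg uv invgK -expg2 -expgM orderXgcd ox.
by rewrite (gcdn_idPr (dvdn_mulr n (dvdnn 4))) mulKn.
Qed.

(* V_8n maps onto the dihedral group of order 4n and, for the factor 2 missing
   when m is odd, onto the one of order 8, with a sent to a reflection and b to
   a rotation. *)
Lemma Q_integral_V (gT : finGroupType) (G : {group gT}) m n :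
  isV G m -> n = (if odd m then 2 * m else m)%N ->
  perfect_square (8 * n%:Z ^+ 2 - 16 * n%:Z + 9) ->
  Q_integral (non_commuting_graph G).
Proof.
move=> isVG n_eq sq; have [m_gt1 _] := isVG.
have [[a [b [defG ar b4 ba ba']]] lower] := isV_gens isVG.
have bab2 : b ^+ 2 * a * b ^+ 2 = a.
  transitivity (b * (b * a * b) * b); first by rewrite !expg2 !mulgA.
  by rewrite ba' -ba !mulgA mulgV mul1g mulgKV.
have cab2 : commute a (b ^+ 2).
  by rewrite /commute -{1}bab2 -mulgA -expgD b4 mulg1.
have ab : a ^ b = a^-1 * b ^+ 2 by rewrite -ba conjgE expg2 !mulgA mulgKV.
have Ab2 : b ^+ 2 \in <<[set a; b ^+ 2]>> by rewrite mem_gen ?set22.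
have Aa : a \in <<[set a; b ^+ 2]>> by rewrite mem_gen ?set21.
apply: (Q_integral_of_commute_square defG cab2) sq.
- by rewrite ab groupM ?groupV.
(* The commutator is b^-2 a^2; its n-th power is trivial because n is even and a multiple of m. *)
- rewrite commgEr conjVg ab invMg invgK -mulgA -expg2 expgMn; last first.
    exact/commute_sym/commuteV/commute_sym/commuteX/commute_sym.
  have /dvdnP[i ni] : m %| n by rewrite n_eq; case: ifP; rewrite ?dvdn_mull.
  have /dvdnP[j nj] : 2 %| n.
    by rewrite n_eq; case: ifP => [_|/negbT]; rewrite ?dvdn_mulr // dvdn2.
  rewrite expVgn -expgM {1}nj mulnCA mulnC expgM b4 expg1n invg1 mul1g.
  by rewrite -expgM ni mulnCA mulnC expgM ar expg1n.
have dvd_m : m %| #|G^`(1)|.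
  have [|||rT [x [y [ox y2 xy _]]]] := @model_commg (2 * m) (2 * m).-1; try lia.
    rewrite -(modnMDl (2 * m).-2 1); congr (_ %% _).
    by case: m m_gt1 {isVG n_eq ar lower} => // k _; rewrite mulnS /=; lia.
  have x2m : x ^+ (2 * m) = 1 by rewrite -ox expg_order.
  have xyV : x ^ y = x^-1.
    by apply: (mulgI x); rewrite xy -expgS prednK ?mulgV //; lia.
  have yV := invg_of_square1 y2.
  have := lower _ x y x2m; rewrite (expgM y 2 2) y2 expg1n yV => /(_ erefl).
  rewrite -{1 3}yV -mulgA -conjgE => /(_ xyV xyV).
  rewrite commgEr conjVg xyV invgK -expg2 orderXgcd ox.
  by rewrite (gcdn_idPr (dvdn_mulr m (dvdnn 2))) mulKn.
rewrite n_eq; case: ifP => // odd_m.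
rewrite Gauss_dvd ?coprime2n // dvd_m andbT.
have [//|//|//|rT [x [y [ox y2 xy oxy]]]] := @model_commg 4 3.
have yV := invg_of_square1 y2; have x4 : x ^+ 4 = 1 by rewrite -ox expg_order.
(* This identity yields both relations for the swapped assignment of a to [y] and b to [x]. *)
have xyx : x * y * x = y.
  by apply: (mulgI y^-1); rewrite mulVg mulgA -conjgE xy -expgSr.
have -> : 2 = #[[~ x, y]] by rewrite -invg_comm orderV oxy.
apply: lower; rewrite ?yV //; first by rewrite expgM y2 expg1n.
by rewrite -{1}xyx !mulgA mulVg mul1g mulgK.
Qed.

(** * Dihedral groups, dihedral central quotients and quasidihedral groups *)

Lemma isD_isM (gT : finGroupType) (G : {group gT}) r : isD G r -> isM G r 1.
Proof. by case. Qed.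

(** The relations bound the order of [G] by the product of the orders of its generators, at most 2n;
    the dihedral group of order 2n is a homomorphic image, so all bounds are attained. *)
Lemma isD_cyclic_index2 (gT : finGroupType) (G : {group gT}) n : isD G n ->
  exists2 a, a \in G & #[a] = n /\ #|G : <[a]>| = 2.
Proof.
case=> n_ge3 isoG; have n_gt1 : 1 < n by lia.
have /existsP[[a b] /=] := isoGrp_hom isoG.
rewrite !xpair_eqE => /and4P[/eqP defG /eqP ar /eqP b2 /eqP ba].
have oG : 2 * n <= #|G|.
  rewrite mul2n -(card_dihedral n_gt1); apply: leq_homg; rewrite isoG.
  have /existsP[[x y] /=] := isoGrp_hom (Grp_dihedral n_gt1).
  rewrite !xpair_eqE => /and4P[defD xn y2 /eqP xy].
  apply/existsP; exists (x, y); rewrite /= !xpair_eqE defD xn y2 /=.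
  by rewrite -xy conjgE (invg_of_square1 (eqP y2)) mulgA.
have Ga : a \in G by rewrite -defG mem_gen ?inE ?cycle_id.
have nab : <[b]> \subset 'N(<[a]>).
  rewrite cycle_subG -groupV inE -cycleJ.
  by rewrite (_ : a ^ b^-1 = a^-1) ?cycleV // conjgE invgK mulgA.
have le_a : #[a] <= n by apply: dvdn_leq; [lia | rewrite order_dvdn ar].
have le_b : #[b] <= 2 by apply: dvdn_leq; rewrite // order_dvdn b2.
have le_G : #|G| <= #[b] * #[a].
  rewrite -defG norm_joinEr // mulnC !orderE mul_cardG leq_pmulr //.
have oa : #[a] = n by nia.
exists a => //; split=> //; rewrite -divgS ?cycle_subG // -orderE oa.
have -> : #|G| = (2 * n)%N by nia.
by rewrite mulnK //; lia.
Qed.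

(** The preimage of the rotation subgroup is abelian, being cyclic modulo a central subgroup. *)
Lemma Q_integral_central_quotient_D (gT : finGroupType) (G : {group gT}) n :
  isD (G / 'Z(G))%G n -> perfect_square (8 * n%:Z ^+ 2 - 16 * n%:Z + 9) ->
  Q_integral (non_commuting_graph G).
Proof.
move=> /isD_cyclic_index2[a Ga [oa iGa]]; pose A := coset 'Z(G) @*^-1 <[a]>.
have nZG := center_normal G.
have sAG : A \subset G by rewrite sub_cosetpre_quo // cycle_subG.
have sZA : 'Z(G) \subset A by apply: sub_cosetpre.
apply: (@Q_integral_abelian_index2 _ _ [group of A]) => //=.
- apply: (cyclic_factor_abelian (H := [group of 'Z(G)])).
    rewrite subsetI sZA centsC (subset_trans sAG) // centsC subsetIr //.
  by rewrite /= cosetpreK cycle_cyclic.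
- rewrite -(index_quotient_eq (H := [group of 'Z(G)])) /=.
  + by rewrite cosetpreK.
  + by rewrite (subset_trans (subsetIr _ _)).
  + exact: sAG.
  exact: normal_norm.
by rewrite -divgS // card_cosetpre mulKn ?cardG_gt0.
Qed.

(** With m = 2^(n - 3), 4m = 2^(n - 1) and 2m = 2^(n - 2), so the presentations coincide. *)
Lemma isQD_isSD (gT : finGroupType) (G : {group gT}) n :
  isQD G n -> isSD G (2 ^ (n - 3)).
Proof.
case=> n_ge4; have [k ->] : exists k, n = k.+4 by exists (n - 4); lia.
rewrite /isSD; have -> : (k.+4 - 3 = k.+1)%N by lia.
have -> : (4 * 2 ^ k.+1 = 2 ^ (k.+4 - 1))%N.
  by rewrite subn1 -(expnD 2 2).
have -> : (2 * 2 ^ k.+1 = 2 ^ (k.+4 - 2))%N.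
  by rewrite -expnS; congr (_ ^ _)%N; lia.
by split=> //; rewrite -{1}(expn0 2) ltn_exp2l.
Qed.

(** * Arithmetic of the seven cases *)

Local Open Scope ring_scope.

Theorem theorem6p1 (gT : finGroupType) (G : {group gT}) :
  (* (a) *)
  (forall r : nat,
     odd r -> perfect_square (8 * r%:Z ^+ 2 - 16 * r%:Z + 9) ->
     isD G r \/ (exists s : nat, isM G r s) \/ isSD G r ->
     Q_integral (non_commuting_graph G)) /\
  (* (b) *)
  (forall n : nat,
     ~~ odd n -> perfect_square (8 * n%:Z ^+ 2 - 16 * n%:Z + 9) ->
     isV G n ->
     Q_integral (non_commuting_graph G)) /\
  (* (c) *)
  (forall n : nat,
     perfect_square (8 * n%:Z ^+ 2 - 16 * n%:Z + 9) ->
     isQ G n \/ isD (G / 'Z(G))%G n ->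
     Q_integral (non_commuting_graph G)) /\
  (* (d) *)
  (forall r : nat,
     ~~ odd r -> perfect_square (2 * r%:Z ^+ 2 - 8 * r%:Z + 9) ->
     isD G r \/ (exists s : nat, isM G r s) ->
     Q_integral (non_commuting_graph G)) /\
  (* (e) *)
  (forall n : nat,
     odd n -> perfect_square (32 * n%:Z ^+ 2 - 32 * n%:Z + 9) ->
     isV G n ->
     Q_integral (non_commuting_graph G)) /\
  (* (f) *)
  (forall n : nat,
     ~~ odd n -> perfect_square (32 * n%:Z ^+ 2 - 32 * n%:Z + 9) ->
     isSD G n ->
     Q_integral (non_commuting_graph G)) /\
  (* (g) *)
  (forall n : nat,
     perfect_square (2 ^+ (2 * n - 1) - 2 ^+ (n + 2) + 9) ->
     isQD G n ->
     Q_integral (non_commuting_graph G)).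
Proof.
have M_odd r s : odd r -> perfect_square (8 * r%:Z ^+ 2 - 16 * r%:Z + 9) ->
    isM G r s -> Q_integral (non_commuting_graph G).
  move=> odd_r sq /Q_integral_M; apply; last exact: sq.
  by rewrite (eqP (_ : coprime r 2)) ?divn1 // coprimen2.
have M_even r s : ~~ odd r -> perfect_square (2 * r%:Z ^+ 2 - 8 * r%:Z + 9) ->
    isM G r s -> Q_integral (non_commuting_graph G).
  move=> even_r sq /Q_integral_M; apply; first by [].
  have r2 : (2 %| r)%N by rewrite dvdn2.
  (* For n = r / 2, 8n^2 - 16n + 9 becomes 2r^2 - 8r + 9. *)
  rewrite (gcdn_idPr r2); move: sq; rewrite -{1 2}(divnK r2) PoszM.
  by congr perfect_square; ring.
have SD_odd r : odd r -> perfect_square (8 * r%:Z ^+ 2 - 16 * r%:Z + 9) ->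
    isSD G r -> Q_integral (non_commuting_graph G).
  move=> odd_r sq isG; have [r_gt1 _] := isG.
  apply: (Q_integral_SD isG) sq.
  (* For r = 2k + 1 the gcd of 4r and 2r - 2 = 4k is 4, so n = r. *)
  have [k rk] : exists k, r = k.*2.+1 by exists r./2; lia.
  have -> : (2 * r - 2 = 4 * k)%N by lia.
  rewrite -muln_gcdr (_ : gcdn r k = 1%N) ?muln1 ?mulKn //.
  by rewrite gcdnC (_ : r = 2 * k + 1)%N ?gcdnMDl ?gcdn1; lia.
have SD_even r : ~~ odd r -> perfect_square (32 * r%:Z ^+ 2 - 32 * r%:Z + 9) ->
    isSD G r -> Q_integral (non_commuting_graph G).
  move=> even_r sq isG; have [r_gt1 _] := isG.
  (* For r even, r - 1 is odd and coprime to 2r, so the gcd of 4r and 2r - 2 is 2. *)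
  apply: (Q_integral_SD (n := 2 * r) isG).
    have -> : (2 * r - 2 = 2 * r.-1)%N by lia.
    have -> : (4 * r = 2 * (2 * r))%N by lia.
    rewrite -muln_gcdr (_ : gcdn _ _ = 1%N) ?muln1 ?mulKn //.
    rewrite gcdnC (_ : 2 * r = 2 * r.-1 + 2)%N ?gcdnMDl; last by lia.
    by apply/eqP; rewrite -/(coprime _ _) coprimen2; lia.
  by move: sq; congr perfect_square; rewrite PoszM; ring.
do 6?split.
- move=> r odd_r sq [/isD_isM|[[s]|]]; last exact: SD_odd.
  + exact: M_odd.
  + exact: M_odd.
- move=> n /negbTE even_n sq isG.
  by apply: (Q_integral_V isG) sq; rewrite even_n.
- move=> n sq [isG | isG]; first exact: Q_integral_Q isG sq.
  exact: Q_integral_central_quotient_D isG sq.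
- by move=> r even_r sq [/isD_isM|[s]]; exact: M_even.
- move=> n odd_n sq isG; apply: (Q_integral_V (n := 2 * n) isG).
    by rewrite odd_n.
  by move: sq; congr perfect_square; rewrite PoszM; ring.
- by [].
(* With r = 2^(n - 3), 32r^2 = 2^(2n - 1) and 32r = 2^(n + 2), which reduces to the even
   semidihedral case. *)
move=> n sq isG; have [n_ge4 _] := isG; apply: SD_even (isQD_isSD isG).
  by rewrite oddX; lia.
have [k nk] : exists k, n = k.+3 by exists (n - 3)%N; lia.
move: sq; congr perfect_square; rewrite nk.
have -> : (k.+3 - 3 = k)%N by lia.
have -> : (2 * k.+3 - 1 = k * 2 + 5)%N by lia.
have -> : (k.+3 + 2 = k + 5)%N by lia.
by rewrite -natz natrX !exprD exprM; ring.
Qed.
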